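(* Let $a_1,\ldots,a_r,b_1,\ldots,b_r,m$ be positive integers. For each $i$, let $K[a_i,b_i]$ be the balanced complete $b_i$-partite graph in which each partite set contains $a_i$ vertices, and let $X=\prod_{i=1}^r K[a_i,b_i]$ be the direct product of these graphs. Then the number of cliques of order $m$ in $X$ is \[\frac{1}{m!}\prod_{k=1}^m\prod_{i=1}^r \mathcal S_{k-1}(a_i,b_i),\] where $\mathcal S_j(x,y)=\max\{x(y-j),0\}$.
   Context: All graphs are finite and simple (no loops). A complete $b$-partite graph is a graph whose vertex set is partitioned into $b$ parts (partite sets) such that two vertices are adjacent if and only if they lie in different parts; it is balanced if all parts have the same size. $K[a,b]$ denotes the balanced complete $b$-partite graph with $a$ vertices in each part (so $ab$ vertices in total). The direct product $\prod_{i=1}^r H_i$ of graphs $H_1,\ldots,H_r$ has vertex set $V(H_1)\times\cdots\times V(H_r)$, and two vertices $(y_1,\ldots,y_r)$ and $(z_1,\ldots,z_r)$ are adjacent if and only if $y_i$ is adjacent to $z_i$ in $H_i$ for every $1\le i\le r$. A clique of order $m$ is a set of $m$ distinct, pairwise adjacent vertices. For integers $x,y\ge 1$ and $j\ge 0$, $\mathcal S_j(x,y)=\max\{x(y-j),0\}$. *)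

(* Defs.v *)
From mathcomp Require Import all_boot all_order all_algebra.

Set Implicit Arguments.
Unset Strict Implicit.
Unset Printing Implicit Defensive.

Import Order.TTheory GRing.Theory Num.Theory.

Record sgraph := SGraph {
  vertex :> finType;
  adj : rel vertex;
  adj_sym : symmetric adj;
  adj_irrefl : irreflexive adj
}.

(* The vertex (p, u) of K[a, b] is the u-th element of the p-th partite set:
   there are b partite sets, of a vertices each. *)
Definition K_adj (a b : nat) : rel ('I_b * 'I_a)%type :=
  fun x y => x.1 != y.1.

Lemma K_adj_sym a b : symmetric (@K_adj a b).
Proof. by move=> x y; rewrite /K_adj eq_sym. Qed.

Lemma K_adj_irrefl a b : irreflexive (@K_adj a b).
Proof. by move=> x; rewrite /K_adj eqxx. Qed.

Definition K (a b : nat) : sgraph := SGraph (@K_adj_sym a b) (@K_adj_irrefl a b).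

Section DirectProduct.

Variables (r : nat) (H : 'I_r -> sgraph).

Definition dprod_adj : rel {dffun forall i : 'I_r, H i} :=
  fun y z => [forall i : 'I_r, adj (y i) (z i)].

Lemma dprod_adj_sym : symmetric dprod_adj.
Proof. by move=> y z; apply: eq_forallb => i; rewrite adj_sym. Qed.

Lemma dprod_adj_irrefl : 0 < r -> irreflexive dprod_adj.
Proof.
move=> r_gt0 y; apply/negP => /forallP/(_ (Ordinal r_gt0)).
by rewrite adj_irrefl.
Qed.

(* The empty product would be a single vertex with a loop, which is not simple,
   hence the argument r_gt0. *)
Definition dprod_graph (r_gt0 : 0 < r) : sgraph :=
  SGraph dprod_adj_sym (dprod_adj_irrefl r_gt0).

End DirectProduct.

Definition is_clique (G : sgraph) (m : nat) (A : {set G}) : bool :=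
  (#|A| == m) && [forall x in A, forall y in A, (x != y) ==> adj x y].

Definition num_cliques (G : sgraph) (m : nat) : nat :=
  #|[set A : {set G} | is_clique m A]|.

(* The difference y - j is taken in int, not truncated in nat. *)
Definition calS (j x y : nat) : int :=
  Num.max (x%:Z * (y%:Z - j%:Z))%R 0%R.

(* Main.v *)
Require Import Defs.
From mathcomp Require Import all_boot all_order all_algebra.

(** Count pairs (clique of order k, common neighbour of it) in two ways: adding
    the neighbour gives a clique of order k + 1 with a marked vertex.  Hence, if
    every clique of order k has exactly c common neighbours, the numbers N of
    cliques satisfy (k + 1) N(k + 1) = c N(k).  Common neighbourhoods in a direct
    product are products of the coordinatewise ones, and a clique of order k
    of the product meets exactly k parts of each factor K[a,b], leaving
    a (b - k) choices for the corresponding coordinate. *)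

Set Implicit Arguments.
Unset Strict Implicit.
Unset Printing Implicit Defensive.

Import Order.TTheory GRing.Theory Num.Theory.

Section CliqueExtension.

Variable G : sgraph.
Implicit Types (A B : {set G}) (v : G) (k : nat).

Definition common_nbrs A : {set G} := [set v | [forall y in A, adj y v]].

Lemma is_cliqueP k A :
  reflect (#|A| = k /\ {in A &, forall x y, x != y -> adj x y}) (is_clique k A).
Proof.
apply: (iffP andP) => [[/eqP cA /forall_inP adjA]|[cA adjA]]; split=> //.
- by move=> x y xA yA; move/forall_inP: (adjA x xA) => /(_ y yA)/implyP.
- exact/eqP.
- by apply/forall_inP=> x xA; apply/forall_inP=> y yA; apply/implyP/adjA.
Qed.

Lemma common_nbrs_notin A v : v \in common_nbrs A -> v \notin A.
Proof.
rewrite inE => /forall_inP adjv; apply/negP => /adjv.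
by rewrite adj_irrefl.
Qed.

Lemma is_clique_setU1 k A v : v \notin A ->
  is_clique k.+1 (v |: A) = is_clique k A && (v \in common_nbrs A).
Proof.
move=> vA; rewrite /is_clique cardsU1 vA add1n eqSS -andbA; congr andb.
apply/forall_inP/andP => [adjU|[/forall_inP adjA]].
  split.
    apply/forall_inP=> x xA; apply/forall_inP=> y yA.
    by move/forall_inP: (adjU x (setU1r v xA)); apply; apply: setU1r.
  rewrite inE; apply/forall_inP=> y yA.
  move/forall_inP: (adjU y (setU1r v yA)) => /(_ v (setU11 v A))/implyP; apply.
  by apply: contraNneq vA => <-.
rewrite inE => /forall_inP adjv x /setU1P xU; apply/forall_inP=> y /setU1P yU.
apply/implyP=> neq_xy; case: xU yU neq_xy => [->|xA] [->|yA] neq_xy.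
- by rewrite eqxx in neq_xy.
- by rewrite adj_sym; apply: adjv.
- exact: adjv.
- by move/forall_inP: (adjA x xA) => /(_ y yA)/implyP; apply.
Qed.

Lemma num_cliques0 : num_cliques G 0 = 1.
Proof.
rewrite /num_cliques (_ : [set A | _] = [set set0]) ?cards1 //.
apply/setP=> A; rewrite !inE; apply/is_cliqueP/eqP => [[/cards0_eq]|->] //.
by split=> [|x]; rewrite ?cards0 ?inE.
Qed.

Lemma num_cliquesS k c :
    (forall A, is_clique k A -> #|common_nbrs A| = c) ->
  k.+1 * num_cliques G k.+1 = c * num_cliques G k.
Proof.
move=> nbrs_c; rewrite /num_cliques ![_ * #|_|]mulnC -!sum_nat_const.
transitivity (\sum_(B : {set G} | is_clique k.+1 B) \sum_(v in B) 1).
  apply: eq_big => [B|B]; rewrite inE // => /is_cliqueP[cB _].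
  by rewrite sum1_card.
transitivity (\sum_(A : {set G} | is_clique k A) \sum_(v in common_nbrs A) 1);
  last by apply: eq_big => [A|A clqA]; rewrite ?inE // sum1_card nbrs_c.
(* With the marked vertex [v] fixed, removing it from [B] is inverse to adding it to a set that
   avoids [v]. *)
rewrite (exchange_big_dep predT) //= [RHS](exchange_big_dep predT) //=.
apply: eq_bigr => v _.
rewrite (reindex_onto (fun A => v |: A) (fun B => B :\ v)) /=; last first.
  by move=> B /andP[_ vB]; rewrite setD1K.
apply: eq_bigl => A; rewrite setU11 andbT.
(* If [v] is in [A], both conditions fail: [A] is not of the form [B :\ v], and [v] is not its own
   neighbour. *)
have [vA|vA] := boolP (v \in A).
  rewrite (_ : (_ :\ v == A) = false) ?andbF; last first.
    by apply: contraTF vA => /eqP <-; rewrite !inE eqxx.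
  by apply/esym/negbTE; rewrite negb_and orbC (contraL (@common_nbrs_notin A v)).
by rewrite setU1K // eqxx andbT is_clique_setU1.
Qed.

(** If no clique has order [k], the value [c k] is unconstrained, but the recurrence then still
    gives zero from order [k.+1] on. *)
Lemma num_cliques_prod c m :
    (forall k A, is_clique k A -> #|common_nbrs A| = c k) ->
  m`! * num_cliques G m = \prod_(k < m) c k.
Proof.
move=> nbrs_c; elim: m => [|m IHm]; first by rewrite num_cliques0 big_ord0.
rewrite big_ord_recr /= -IHm factS mulnAC (num_cliquesS (nbrs_c m)).
by rewrite [RHS]mulnC [m`! * _]mulnC mulnA.
Qed.

End CliqueExtension.

(** Adjacency is coordinatewise, so the quantifiers over [y] in [A] and over [i] commute: each
    coordinate of a common neighbour is chosen independently. *)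
Lemma card_common_nbrs_dprod r (H : 'I_r -> sgraph) (r_gt0 : 0 < r)
    (A : {set dprod_graph H r_gt0}) :
  #|common_nbrs A| =
    \prod_(i < r) #|common_nbrs [set (y : {dffun forall i, H i}) i | y in A]|.
Proof.
(* The product takes the [foldr] form in which [card_family] counts dependent functions. *)
rewrite -big_enum /=.
transitivity (foldr muln 1 [seq #|common_nbrs
    [set (y : {dffun forall i, H i}) i | y in A]| | i : 'I_r]); last first.
  rewrite /image_mem; elim: (enum _) => [|i s IHs]; first by rewrite big_nil.
  by rewrite big_cons /= IHs.
rewrite -(card_family (fun i => mem (common_nbrs
  [set (y : {dffun forall i, H i}) i | y in A]))).
apply: eq_card => v; rewrite inE; apply/forall_inP/familyP => [adjv i|adjv y yA].
  rewrite inE; apply/forall_inP=> _ /imsetP[y yA ->].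
  by move/forallP: (adjv y yA).
apply/forallP=> i; have := adjv i; rewrite inE => /forall_inP; apply.
by apply/imsetP; exists y.
Qed.

(** Distinct vertices of [A] are adjacent in every coordinate, hence differ there, so projecting
    loses no vertex. *)
Lemma is_clique_dprod_proj r (H : 'I_r -> sgraph) (r_gt0 : 0 < r) i k
    (A : {set dprod_graph H r_gt0}) :
  is_clique k A -> is_clique k [set (y : {dffun forall i, H i}) i | y in A].
Proof.
case/is_cliqueP=> cA adjA.
have adj_i y z : y \in A -> z \in A -> y != z ->
    adj ((y : {dffun forall i, H i}) i) ((z : {dffun forall i, H i}) i).
  by move=> yA zA /(adjA y z yA zA)/forallP.
apply/is_cliqueP; split.
  rewrite card_in_imset // => y z yA zA eq_yz; apply/eqP/idPn => /(adj_i y z yA zA).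
  by rewrite eq_yz adj_irrefl.
move=> _ _ /imsetP[y yA ->] /imsetP[z zA ->] neq_yz; apply: adj_i => //.
by apply: contraNneq neq_yz => ->.
Qed.

(** The vertices of a clique lie in distinct parts; its common neighbours fill the parts that it
    misses. *)
Lemma card_common_nbrs_K a b k (A : {set K a b}) :
  is_clique k A -> #|common_nbrs A| = a * (b - k).
Proof.
case/is_cliqueP=> cA adjA.
have -> : common_nbrs A = setX (~: [set y.1 | y in A]) [set: 'I_a].
  apply/setP=> v; rewrite !inE andbT.
  apply/forall_inP/idP => [adjv|vA y yA].
    apply/imsetP=> -[y /adjv /= neq_yv eq_vy].
    by rewrite /K_adj eq_vy eqxx in neq_yv.
  by apply: contraNneq vA => <-; apply: imset_f.
rewrite cardsX cardsT card_ord cardsCs setCK card_ord card_in_imset ?cA.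
  by rewrite mulnC.
by move=> y z yA zA eq_yz; apply/eqP/idPn => /(adjA y z yA zA)/eqP.
Qed.

(** Truncated subtraction in [nat] does the work of the maximum with 0. *)
Lemma calSE j x y : calS j x y = Posz (x * (y - j)).
Proof.
rewrite /calS PoszM; case: (leqP j y) => [le_jy|/ltnW le_yj].
  by rewrite subzn // max_l // mulr_ge0.
rewrite max_r; first by move: le_yj; rewrite -subn_eq0 => /eqP ->; rewrite mulr0.
by rewrite mulr_ge0_le0 // subr_le0.
Qed.

Theorem mainTheorem1 (r m : nat) (a b : 'I_r -> nat)
    (r_gt0 : 0 < r) (m_gt0 : 0 < m)
    (a_gt0 : forall i, 0 < a i) (b_gt0 : forall i, 0 < b i) :
  ((num_cliques (dprod_graph (fun i => K (a i) (b i)) r_gt0) m)%:R =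
   (m`!)%:R^-1 *
   \prod_(1 <= k < m.+1) \prod_(i < r) (calS k.-1 (a i) (b i))%:~R :> rat)%R.
Proof.
set X := dprod_graph _ _.
have nbrsX k (A : {set X}) :
    is_clique k A -> #|common_nbrs A| = \prod_(i < r) (a i * (b i - k)).
  move=> clqA; rewrite card_common_nbrs_dprod; apply: eq_bigr => i _.
  exact/card_common_nbrs_K/is_clique_dprod_proj.
have -> : (\prod_(1 <= k < m.+1) \prod_(i < r) (calS k.-1 (a i) (b i))%:~R
    = (m`! * num_cliques X m)%:R :> rat)%R.
  (* Shifting the index turns [k.-1] for [k] from 1 to [m] into [k < m], the order of the clique
     being extended. *)
  rewrite (num_cliques_prod m nbrsX) big_add1 /= big_mkord natr_prod.
  apply: eq_bigr => k _; rewrite natr_prod; apply: eq_bigr => i _.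
  by rewrite calSE.
by rewrite natrM mulKf // pnatr_eq0 -lt0n fact_gt0.
Qed.
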